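(* For every integer $n \ge 3$: $\phi_{4n}(2) = v(n)$ if $v(n) \equiv 1 \pmod 4$ or $v(n) = 2$, and $\phi_{4n}(2) = -v(n)$ if $v(n) \equiv -1 \pmod 4$.
   Context: For an integer $m \ge 3$, let $\phi_m(x) \in \mathbb{Z}[x]$ denote the minimal polynomial of $4\sin^2\left(\frac{\pi}{m}\right)$, normalized (up to sign) so that its constant term is positive; equivalently, $\phi_m(x) = \prod_{0 < j < \frac{m}{2},\ \gcd(j,m)=1} \left(4\sin^2\left(\frac{j\pi}{m}\right) - x\right)$. For an integer $n > 1$, define $v(n) = p$ if $n = p^k$ is a power ($k \ge 1$) of a prime $p$, and $v(n) = 1$ otherwise. *)

(* Defs.v *)
From HB Require Import structures.
From mathcomp Require Import all_boot all_order all_algebra.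
From mathcomp Require Import all_classical all_reals all_analysis.

Set Implicit Arguments.
Unset Strict Implicit.
Unset Printing Implicit Defensive.

Import Order.TTheory GRing.Theory Num.Theory.

Local Open Scope ring_scope.

(* Same characterization as [minCpolyP] in [algC]: the monic generator of the
   ideal of rational polynomials vanishing at [x]. *)
Definition is_minpoly (R : realType) (x : R) (p : {poly rat}) : Prop :=
  p \is monic /\
  forall q : {poly rat}, root (map_poly (ratr : rat -> R) q) x = (p %| q).

Definition sin2_pi (R : realType) (m : nat) : R :=
  4%:R * sin (pi / m%:R) ^+ 2.

(* The rational minimal polynomial is monic, so "up to sign" means that [p]
   or [- p] is that polynomial; the constant term fixes the sign. *)
Definition is_phi (R : realType) (m : nat) (p : {poly int}) : Prop :=
  (is_minpoly (sin2_pi R m) (map_poly intr p) \/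
   is_minpoly (sin2_pi R m) (map_poly intr (- p))) /\
  0 < p`_0.

(* [is_phi R m] has at most one solution, so the choice made by [xget] is
   immaterial; the default value 0 does not satisfy [is_phi R m]. *)
Definition phi (R : realType) (m : nat) : {poly int} :=
  xget 0 [set p | is_phi R m p]%classic.

(* [primes n] is the duplicate-free list of the prime divisors of [n]; see
   [vpp_prime_power] and [vpp_other]. *)
Definition vpp (n : nat) : nat := if primes n is [:: p] then p else 1%N.

Lemma vpp_prime_power (p k : nat) : prime p -> (0 < k)%N -> vpp (p ^ k) = p.
Proof. by move=> p_pr k_gt0; rewrite /vpp primesX // primes_prime. Qed.

Lemma vpp_other (n : nat) : (1 < n)%N ->
  (forall p k : nat, prime p -> (0 < k)%N -> n <> (p ^ k)%N) -> vpp n = 1%N.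
Proof.
move=> n_gt1 nPk; rewrite /vpp; case Dn: (primes n) => [|p [|q s]] //.
have n_gt0 := ltnW n_gt1.
have: p \in primes n by rewrite Dn mem_head.
rewrite mem_primes => /and3P[p_pr _ p_n].
case: (nPk p (logn p n) p_pr); first by rewrite logn_gt0 Dn mem_head.
by rewrite [LHS](prod_prime_decomp n_gt0) prime_decompE Dn /= big_seq1.
Qed.

Lemma is_phi_uniq (R : realType) (m : nat) (p q : {poly int}) :
  is_phi R m p -> is_phi R m q -> p = q.
Proof.
have toQ_inj : injective (map_poly (intr : int -> rat)).
  by apply: map_inj_poly => //; apply: intr_inj.
have eqm x (a b : {poly int}) : is_minpoly (R := R) x (map_poly intr a) ->
    is_minpoly x (map_poly intr b) -> a = b.
  move=> [a_mon aP] [b_mon bP]; apply: toQ_inj; apply/eqP.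
  have a_dvd_b : map_poly intr a %| map_poly (intr : int -> rat) b.
    by rewrite -aP bP dvdpp.
  have b_dvd_a : map_poly intr b %| map_poly (intr : int -> rat) a.
    by rewrite -bP aP dvdpp.
  by rewrite -eqp_monic // /eqp a_dvd_b.
move=> [Hp p0] [Hq q0]; case: Hp Hq => Hp [] Hq.
- exact: eqm Hp Hq.
- by move: p0; rewrite (eqm _ _ _ Hp Hq) coefN oppr_gt0 ltNge ltW.
- by move: q0; rewrite (eqm _ _ _ Hq Hp) coefN oppr_gt0 ltNge ltW.
- by apply: oppr_inj; apply: eqm Hp Hq.
Qed.

(* Main.v *)
Require Import Defs.
From HB Require Import structures.
From mathcomp Require Import all_boot all_order all_algebra.
From mathcomp Require Import all_field.
From mathcomp Require Import all_classical all_reals all_analysis.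
From mathcomp Require Import complex.
From mathcomp Require Import zify ring.

(* Put m = 4n, d = totient(m)/2.  The cyclotomic polynomial Phi_m is
   palindromic, hence of the form Phi_m(X) = X^d p(-(X - 1)^2 / X) with p an
   integer polynomial of degree d; at X = exp(2 i pi / m) the argument of p is
   4 sin^2(pi / m).  Irreducibility of Phi_m makes p, up to sign, the minimal
   polynomial of that number, and p(0) = Phi_m(1) > 0, so that p is phi_m.
   At X = i the argument of p is 2, hence i^d p(2) = Phi_{4n}(i).  Finally
   Phi_{4n}(X) is Phi_n(X^4) for n even and Phi_n(-X^2) for n odd, so
   Phi_{4n}(i) = Phi_n(1) = v(n), and the sign is read off d mod 4. *)

Import Order.TTheory GRing.Theory Num.Theory.

Local Open Scope ring_scope.

(** * Cyclotomic polynomials and primitive roots in a field *)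

(** As z^n = 1, some factor Phi_d of X^n - 1 vanishes at z. Then z^d = 1, so n divides d, and d =
    n. *)
Lemma root_Cyclotomic (F : fieldType) (n : nat) (z : F) :
  n.-primitive_root z -> root (map_poly intr (Cyclotomic n)) z.
Proof.
move=> prim_z; have n_gt0 := prim_order_gt0 prim_z.
have prod0 m : (0 < m)%N -> \prod_(d <- divisors m)
    (map_poly (intr : int -> F) (Cyclotomic d)).[z] = z ^+ m - 1.
  move=> m_gt0; rewrite -horner_prod -rmorph_prod /= prod_Cyclotomic //.
  by rewrite rmorphB rmorph1 /= map_polyXn !hornerE.
have /eqP := prod0 n n_gt0; rewrite (prim_expr_order prim_z) subrr.
rewrite prodf_seq_eq0 => /hasP[d]; rewrite -dvdn_divisors //= => d_n zd.
have d_gt0 := dvdn_gt0 n_gt0 d_n.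
suff n_d : (n %| d)%N.
  by rewrite rootE; have /eqP-> : n == d by rewrite eqn_dvd n_d.
rewrite (prim_order_dvd prim_z) -subr_eq0 -prod0 // (big_rem d) /=.
  by rewrite (eqP zd) mul0r.
by rewrite -dvdn_divisors.
Qed.

(** Irreducibility is carried over from [algC] to [F]. The rational gcd g of c and q vanishes at z,
    hence is not constant. Write c = h g: a primitive root w in [algC] kills h or g, so c divides
    one of them, and h has too small a degree. *)
Lemma root_ratr_Cyclotomic (F : numFieldType) (n : nat) (z : F)
    (q : {poly rat}) :
  n.-primitive_root z ->
  root (map_poly ratr q) z = (map_poly intr (Cyclotomic n) %| q).
Proof.
set c := map_poly intr _ => prim_z; have n_gt0 := prim_order_gt0 prim_z.
have ratrZ (G : numFieldType) (p : {poly int}) :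
    map_poly ratr (map_poly (intr : int -> rat) p) =
    map_poly (intr : int -> G) p.
  by rewrite -map_poly_comp; apply: eq_map_poly => a /=; rewrite ratr_int.
have c_neq0 : c != 0 by rewrite monic_neq0 // monic_map // Cyclotomic_monic.
have rc : root (map_poly ratr c) z by rewrite ratrZ root_Cyclotomic.
have [w prim_w] := C_prim_root_exists n_gt0.
have wP (p : {poly rat}) : root (map_poly ratr p) w = (c %| p).
  have [p0 [Dp0 p0_mon] ->] := minCpolyP w.
  suff -> : p0 = c by [].
  apply: (@map_poly_inj _ _ (ratr : {rmorphism rat -> algC})).
  by rewrite -Dp0 ratrZ (Cintr_Cyclotomic prim_w) (minCpoly_cyclotomic prim_w).
apply/idP/idP => [qz | /dvdpP[r ->]]; last by rewrite rmorphM rootM rc orbT.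
set g := gcdp c q.
have g_neq0 : g != 0 by rewrite gcdp_eq0 negb_and c_neq0.
have rg : root (map_poly ratr g) z by rewrite gcdp_map root_gcd rc.
have g_gt1 : (1 < size g)%N.
  rewrite -(size_map_poly (ratr : {rmorphism rat -> F})).
  by apply: root_size_gt1 rg; rewrite map_poly_eq0.
suff : c %| g by move/dvdp_trans; apply; apply: dvdp_gcdr.
have /dvdpP[h Dh] := dvdp_gcdl c q; rewrite -/g in Dh.
have : root (map_poly ratr c) w by rewrite wP.
rewrite {1}Dh rmorphM rootM !wP => /orP[|//] c_h.
have h_neq0 : h != 0.
  by apply: contra_neq c_neq0; rewrite Dh => ->; rewrite mul0r.
suff : False by [].
have := dvdp_leq h_neq0 c_h; rewrite Dh size_mul //.
by move: (size h) (size g) g_gt1; lia.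
Qed.

(** * The value of Phi_n at 1 *)

Lemma divisors_primes_eq (n p : nat) : (0 < n)%N -> prime p ->
  perm_eq [seq d <- divisors n | primes d == [:: p]]
          [seq (p ^ i)%N | i <- iota 1 (logn p n)].
Proof.
move=> n_gt0 p_pr; apply: uniq_perm.
- by rewrite filter_uniq ?divisors_uniq.
- by rewrite map_inj_uniq ?iota_uniq //; apply: expnI; apply: prime_gt1.
move=> d; rewrite mem_filter -dvdn_divisors //.
apply/andP/mapP => [[/eqP Dd d_n] | [j]].
  have d_gt0 := dvdn_gt0 n_gt0 d_n.
  exists (logn p d).
    rewrite mem_iota add1n ltnS logn_gt0 Dd mem_head /=.
    by rewrite dvdn_leq_log.
  by rewrite [LHS](prod_prime_decomp d_gt0) prime_decompE Dd /= big_seq1.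
rewrite mem_iota add1n ltnS => /andP[j_gt0 j_le] ->.
by rewrite primesX // primes_prime // eqxx pfactor_dvdn.
Qed.

Lemma vppE (n : nat) :
  vpp n = (\prod_(p <- primes n) (if primes n == [:: p] then p else 1%N))%N.
Proof.
rewrite /vpp; case: (primes n) => [|p [|q s]]; first by rewrite big_nil.
  by rewrite big_seq1 eqxx.
by rewrite big1 // => r _; rewrite eqseq_cons andbF.
Qed.

(** A prime p contributes one factor p for each of the divisors p, p^2, ..., p^(logn p n). *)
Lemma prod_vpp (n : nat) : (0 < n)%N -> (\prod_(d <- divisors n) vpp d)%N = n.
Proof.
move=> n_gt0.
(* The primes range over those of n instead of d, so that the two products can be exchanged. *)
have vppE' d : d \in divisors n ->
    vpp d = (\prod_(p <- primes n) (if primes d == [:: p] then p else 1%N))%N.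
  rewrite -dvdn_divisors // => d_n; have d_gt0 := dvdn_gt0 n_gt0 d_n.
  rewrite /vpp; case Dd: (primes d) => [|p [|q s]]; first by rewrite big1.
    rewrite (bigD1_seq p) ?primes_uniq //=; last first.
      have : p \in primes d by rewrite Dd mem_head.
      rewrite !mem_primes n_gt0 d_gt0 => /and3P[-> _ /=] p_d.
      exact: dvdn_trans p_d d_n.
    rewrite eqxx big1 ?muln1 // => q q_p.
    by rewrite eqseq_cons eq_sym (negPf q_p).
  by rewrite big1 // => r _; rewrite eqseq_cons andbF.
rewrite (eq_big_seq _ vppE') exchange_big /=.
rewrite [RHS](prod_prime_decomp n_gt0) prime_decompE big_map /=.
apply: eq_big_seq => p; rewrite mem_primes => /andP[p_pr _].
rewrite -big_mkcond -big_filter /=.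
rewrite (perm_big _ (divisors_primes_eq _ _ n_gt0 p_pr)).
by rewrite big_const_seq count_predT size_map size_iota iter_muln_1.
Qed.

Lemma vpp_gt0 (n : nat) : (0 < vpp n)%N.
Proof.
rewrite vppE big_seq prodn_cond_gt0 // => p; rewrite mem_primes.
by case: ifP => // _ /andP[/prime_gt0].
Qed.

(** Over the divisors d > 1 of n, the values Phi_d(1) multiply to n, because (X^n - 1) / (X - 1) is
    the sum of the X^i with i < n; so do the [vpp d]. By strong induction the factors with d < n
    agree and cancel. *)
Lemma Cyclotomic_at1 (n : nat) : (1 < n)%N -> (Cyclotomic n).[1] = (vpp n)%:Z.
Proof.
elim/ltn_ind: n => n IHn n_gt1; have n_gt0 := ltnW n_gt1.
have n_div1 : n \in rem 1%N (divisors n).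
  by rewrite mem_rem_uniq ?divisors_uniq // inE -dvdn_divisors ?dvdnn //
    gtn_eqF.
have mem1 : 1%N \in divisors n by rewrite -dvdn_divisors.
have Phi1 : Cyclotomic 1 = 'X - 1.
  have := prod_Cyclotomic (ltn0Sn 0).
  by rewrite (_ : divisors 1 = [:: 1%N]) // big_seq1 expr1.
have key : \prod_(d <- rem 1%N (divisors n)) (Cyclotomic d).[1] = n%:Z.
  rewrite -horner_prod.
  have -> : \prod_(d <- rem 1%N (divisors n)) Cyclotomic d = \sum_(i < n) 'X^i.
    have X1 : ('X - 1 : {poly int}) != 0 by rewrite polyXsubC_eq0.
    apply: (mulfI X1); rewrite -Phi1.
    by have := prod_Cyclotomic n_gt0; rewrite (big_rem _ mem1) /= subrX1 Phi1.
  rewrite horner_sum (eq_bigr (fun=> 1)) => [|i _]; last first.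
    by rewrite hornerXn expr1n.
  by rewrite sumr_const card_ord natz.
have keyv : \prod_(d <- rem 1%N (divisors n)) (vpp d)%:Z = n%:Z.
  rewrite -[in RHS](prod_vpp n n_gt0) (big_rem _ mem1) /= mul1n.
  by elim/big_rec2: _ => // d a b _ ->; rewrite PoszM.
move: key; rewrite -keyv (big_rem _ n_div1) [in RHS](big_rem _ n_div1) /=.
set r := rem n _.
rewrite (eq_big_seq (fun d => (vpp d)%:Z)) => [|d].
  apply: mulIf; rewrite prodf_seq_neq0; apply/allP => d _ /=.
  by rewrite eqz_nat -lt0n vpp_gt0.
rewrite mem_rem_uniq ?rem_uniq ?divisors_uniq // inE /=.
rewrite mem_rem_uniq ?divisors_uniq // inE /= -dvdn_divisors //.
case/and3P=> d_n d_1 /[dup] /(dvdn_gt0 n_gt0) d_gt0 /dvdn_leq d_le.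
by apply: IHn; rewrite ltn_neqAle ?d_n ?d_le // eq_sym d_1.
Qed.

(** * Palindromic polynomials and the substitution -(X - 1)^2 / X *)

(* The polynomial X^d p(-(X - 1)^2 / X), for p of degree at most d. *)
Definition csub {R : comNzRingType} (d : nat) (p : {poly R}) : {poly R} :=
  \sum_(i < d.+1) p`_i *: ((- ('X - 1) ^+ 2) ^+ i * 'X^(d - i)).

(** The relation w = -(z - 1)^2 / z is stated without division, which lets it be used over [int] at
    z = 1 with w = 0. *)
Lemma horner_csub (R : comNzRingType) (d : nat) (p : {poly R}) (z w : R) :
  (size p <= d.+1)%N -> - (z - 1) ^+ 2 = w * z ->
  (csub d p).[z] = z ^+ d * p.[w].
Proof.
move=> sz_p zw; rewrite horner_sum (horner_coef_wide w sz_p) mulr_sumr.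
apply: eq_bigr => i _; rewrite !hornerE zw exprMn.
have -> : z ^+ d = z ^+ i * z ^+ (d - i) by rewrite -exprD subnKC // -ltnS.
by rewrite /=; ring.
Qed.

Lemma map_csub (R S : comNzRingType) (f : {rmorphism R -> S}) (d : nat)
    (p : {poly R}) : map_poly f (csub d p) = csub d (map_poly f p).
Proof.
rewrite rmorph_sum; apply: eq_bigr => i _ /=.
by rewrite map_polyZ coef_map rmorphM !rmorphXn rmorphN rmorphXn rmorphB rmorph1
  /= map_polyX.
Qed.

(** Only the summand i = d survives at X = 0. This links the top coefficient of p to a constant
    term. *)
Lemma coef0_csub (R : comNzRingType) (d : nat) (p : {poly R}) :
  (csub d p)`_0 = (-1) ^+ d * p`_d.
Proof.
rewrite -!horner_coef0 horner_sum big_ord_recr /= subnn expr0 mulr1.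
rewrite big1 => [|i _]; last first.
  by rewrite !hornerE /= expr0n subn_eq0 leqNgt ltn_ord !mulr0.
by rewrite add0r !hornerE /= sqrrN expr1n mulrC.
Qed.

Lemma size_csub (R : comNzRingType) (d : nat) (p : {poly R}) :
  (size (csub d p) <= d.*2.+1)%N.
Proof.
apply: (leq_trans (size_sum _ _ _)); apply/bigmax_leqP => i _.
apply: (leq_trans (size_scale_leq _ _)).
apply: (leq_trans (size_polyMleq _ _)); rewrite size_polyXn addnS /=.
have := size_poly_exp_leq (- ('X - 1 : {poly R}) ^+ 2) i.
have : ((size (- ('X - 1 : {poly R}) ^+ 2)).-1 <= 2)%N.
  rewrite size_polyN -subn1 leq_subLR.
  by apply: (leq_trans (size_poly_exp_leq _ _)); rewrite size_XsubC.
have := ltn_ord i; move: (size _) (size _) => a b; nia.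
Qed.

Lemma coef_1subX_exp (R : comNzRingType) (n k : nat) :
  ((1 - 'X : {poly R}) ^+ n)`_k = (-1) ^+ k *+ 'C(n, k).
Proof.
have signC i : (-1) ^+ i = ((-1) ^+ i)%:P :> {poly R}.
  by rewrite polyC_exp polyCN polyC1.
rewrite exprBn coef_sum.
under eq_bigr => i _ do rewrite expr1n mulr1 coefMn signC coefCM coefXn.
have [k_le | k_gt] := leqP k n.
  rewrite (bigD1 (Ordinal (k_le : (k < n.+1)%N))) //= eqxx mulr1.
  by rewrite big1 ?addr0 // => i /negPf; rewrite eq_sym -val_eqE /= => ->;
    rewrite mulr0 mul0rn.
rewrite bin_small // mulr0n big1 // => i _.
by rewrite gtn_eqF ?mulr0 ?mul0rn //; apply: leq_ltn_trans k_gt; rewrite -ltnS.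
Qed.

(** Induction on d: subtracting a multiple of the palindromic polynomial A^(d+1) kills the constant
    coefficient of P, hence by symmetry the one of index 2(d+1). Dividing by X leaves a palindromic
    polynomial for d. *)
Lemma palindromic_csub (R : comNzRingType) (d : nat) (P : {poly R}) :
  (size P <= d.*2.+1)%N ->
  (forall i, (i <= d.*2)%N -> P`_i = P`_(d.*2 - i)) ->
  exists2 p : {poly R}, (size p <= d.+1)%N & P = csub d p.
Proof.
elim: d P => [|d IHd] P szP palP.
  exists P => //; rewrite /csub big_ord1 mulr1 [LHS]size1_polyC //.
  by rewrite -mul_polyC mulr1.
pose A : {poly R} := - ('X - 1) ^+ 2.
(* The sign makes up for the constant coefficient (-1)^(d+1) of A^(d+1). *)
pose c : R := P`_0 * (-1) ^+ d.+1.
have AE : A ^+ d.+1 = (-1) ^+ d.+1 * (1 - 'X) ^+ d.+1.*2.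
  by rewrite -mul2n exprM -exprMn mulN1r -sqrrN opprB.
have coefA i :
      (A ^+ d.+1)`_i = (-1) ^+ d.+1 * ((-1) ^+ i *+ 'C(d.+1.*2, i)).
  by rewrite AE -coef_1subX_exp -coefCM polyC_exp polyCN polyC1.
pose Q := P - c *: A ^+ d.+1.
have palQ i : (i <= d.+1.*2)%N -> Q`_i = Q`_(d.+1.*2 - i).
  move=> i_le; rewrite !coefB !coefZ palP // !coefA bin_sub //.
  by rewrite -[(-1) ^+ (_ - i)]signr_odd oddB // odd_double signr_odd.
have Q0 : Q`_0 = 0.
  by rewrite coefB coefZ coefA bin0 mulr1n mulr1 -mulrA -exprMn mulrN1 opprK
    expr1n mulr1 subrr.
have szQ i : (d.+1.*2 <= i)%N -> Q`_i = 0.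
  rewrite leq_eqVlt => /orP[/eqP <-|i_gt].
    by rewrite palQ // subnn.
  rewrite coefB coefZ coefA bin_small // mulr0n !mulr0 subr0.
  by rewrite nth_default //; apply: leq_trans szP _.
pose Q' := \poly_(i < d.*2.+1) Q`_i.+1.
have QE : Q = 'X * Q'.
  apply/polyP => -[|i]; rewrite coefXM //= coef_poly.
  by case: ltnP => // i_ge; rewrite szQ // doubleS !ltnS.
have [||p szp Q'E] := IHd Q'; first exact: size_poly.
  move=> i i_le; rewrite !coef_poly !ltnS i_le leq_subr palQ; last first.
    by rewrite doubleS ltnS ltnW.
  by rewrite doubleS subSS subSn.
(* The new top term yields c A^(d+1); the terms of p gain one factor X when d becomes d + 1. *)
exists (p + c *: 'X^(d.+1)).
  apply: (leq_trans (size_polyD _ _)); rewrite geq_max (leq_trans szp) //=.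
  by apply: (leq_trans (size_scale_leq _ _)); rewrite size_polyXn.
have -> : P = 'X * csub d p + c *: A ^+ d.+1.
  by rewrite -Q'E -QE /Q subrK.
rewrite /csub [RHS]big_ord_recr /= subnn expr0 mulr1 coefD coefZ coefXn eqxx
  mulr1.
rewrite [p`_d.+1]nth_default // add0r; congr (_ + _).
rewrite mulr_sumr; apply: eq_bigr => i _.
rewrite coefD coefZ coefXn ltn_eqF // mulr0 addr0 -scalerAr; congr (_ *: _).
by rewrite subSn -1?ltnS // ['X^(_.+1)]exprS mulrCA.
Qed.

(** * Characterization and symmetry of cyclotomic polynomials *)

Lemma Cyclotomic_unique (F : numFieldType) (n : nat) (z : F) (P : {poly int}) :
  n.-primitive_root z -> root (map_poly intr P) z -> P \is monic ->
  size P = (totient n).+1 -> Cyclotomic n = P.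
Proof.
move=> prim_z Pz P_mon szP.
have injZQ : injective (intr : int -> rat) by apply: intr_inj.
apply: (map_inj_poly injZQ) => //; apply/eqP.
rewrite -eqp_monic ?monic_map ?Cyclotomic_monic // -dvdp_size_eqp.
  by rewrite !size_map_inj_poly // szP size_Cyclotomic.
rewrite -(root_ratr_Cyclotomic _ _ _ _ prim_z) -map_poly_comp.
by rewrite (eq_map_poly (ratr_int F)).
Qed.

Lemma prim_rootV (F : fieldType) (n : nat) (z : F) :
  n.-primitive_root z -> n.-primitive_root z^-1.
Proof.
move=> prim_z; have n_gt0 := prim_order_gt0 prim_z.
have -> : z^-1 = z ^+ n.-1.
  apply: (@mulrI _ z); first by rewrite unitfE (prim_root_eq0 prim_z) -lt0n.
  rewrite -exprS prednK // (prim_expr_order prim_z) divff //.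
  by rewrite (prim_root_eq0 prim_z) -lt0n.
by rewrite prim_root_exp_coprime // coprime_sym coprimenP.
Qed.

(** The reversed polynomial r vanishes at z because z^-1 is primitive too. So Phi_n divides r, and
    by degree r = a Phi_n. Both take the same value at 1, nonzero since n > 1, whence a = 1. *)
Lemma Cyclotomic_palindromic (n i : nat) : (1 < n)%N -> (i <= totient n)%N ->
  (Cyclotomic n)`_i = (Cyclotomic n)`_(totient n - i).
Proof.
move=> n_gt1; set t := totient n; set c := Cyclotomic n.
have [z prim_z] := C_prim_root_exists (ltnW n_gt1).
have z_neq0 : z != 0 by rewrite (prim_root_eq0 prim_z) -lt0n ltnW.
pose r := \poly_(j < t.+1) c`_(t - j).
have szc : size c = t.+1 by rewrite size_Cyclotomic.
have horner_r (F : fieldType) (x : F) : x != 0 ->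
    (map_poly intr r).[x] = x ^+ t * (map_poly intr c).[x^-1].
  move=> x0; rewrite (@horner_coef_wide _ t.+1); last first.
    by apply: leq_trans (size_poly _ _) _; apply: size_poly.
  rewrite [in RHS](@horner_coef_wide _ t.+1); last first.
    by rewrite -szc size_poly.
  rewrite mulr_sumr [RHS](reindex_inj rev_ord_inj) /=; apply: eq_bigr => j _.
  rewrite !coef_map coef_poly ltn_ord /= subSS mulrCA exprVn; congr (_ * _).
  have j_le : (j <= t)%N by rewrite -ltnS.
  by apply: (canRL (mulfK _)); rewrite ?expf_neq0 // -exprD subnKC.
have rz : root (map_poly ratr (map_poly (intr : int -> rat) r)) z.
  rewrite -map_poly_comp (eq_map_poly (ratr_int _)) rootE horner_r //.
  have /eqP -> := root_Cyclotomic _ _ _ (prim_rootV _ _ _ prim_z).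
  by rewrite mulr0.
have injZQ : injective (intr : int -> rat) by apply: intr_inj.
have c1_neq0 : (map_poly (intr : int -> rat) c).[1] != 0.
  by rewrite -[1]/(1%:~R) horner_map /= Cyclotomic_at1 //
    intr_eq0 eqz_nat -lt0n vpp_gt0.
have r1 : (map_poly (intr : int -> rat) r).[1] = (map_poly intr c).[1].
  by rewrite horner_r ?oner_eq0 // invr1 expr1n mul1r.
have r_neq0 : map_poly (intr : int -> rat) r != 0.
  by apply: contra_neq c1_neq0; rewrite -r1 => ->; rewrite horner0.
rewrite (root_ratr_Cyclotomic _ _ _ _ prim_z) in rz.
have : map_poly intr c %= map_poly (intr : int -> rat) r.
  rewrite -dvdp_size_eqp // eqn_leq dvdp_leq // !size_map_inj_poly // szc.
  exact: size_poly.
rewrite eqp_sym => /eqpf_eq[a _ Da].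
have a1 : a = 1.
  by apply: (mulIf c1_neq0); rewrite mul1r -[LHS]hornerZ -Da.
have {Da a1} Dr : r = c.
  by apply: (map_inj_poly injZQ) => //; rewrite Da a1 scale1r.
by move=> i_le; rewrite -{1}Dr coef_poly ltnS i_le.
Qed.

(** * Totients, and the value of Phi_{4n} at i *)

(** An odd prime factor p of n contributes the even factor p - 1; otherwise n is a power of 2 that
    is at least 4. *)
Lemma dvdn_totient_even (n : nat) : (2 < n)%N -> (2 %| totient n)%N.
Proof.
move=> n_gt2; have n_gt0 : (0 < n)%N by apply: leq_trans n_gt2.
have split_p p : prime p -> (p %| n)%N ->
    (p.-1 * p ^ (logn p n).-1 %| totient n)%N.
  move=> p_pr p_n; have [m co_pm Dn] := pfactor_coprime p_pr n_gt0.
  have l_gt0 : (0 < logn p n)%N by rewrite logn_gt0 mem_primes p_pr n_gt0.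
  rewrite {2}Dn totient_coprime ?coprimeXr 1?coprime_sym //.
  by rewrite totient_pfactor // dvdn_mull.
have [m co2m Dn] := pfactor_coprime (isT : prime 2) n_gt0.
have m_odd : odd m by rewrite -coprime2n.
have [m_gt1 | m_le1] := ltnP 1 m.
  have p_pr := pdiv_prime m_gt1; have p_n : (pdiv m %| n)%N.
    by rewrite Dn dvdn_mulr ?pdiv_dvd.
  apply: dvdn_trans (split_p _ p_pr p_n).
  rewrite dvdn_mulr // dvdn2 -oddS prednK ?prime_gt0 //.
  exact: dvdn_odd (pdiv_dvd m) m_odd.
have m1 : m = 1%N by case: m m_odd m_le1 {co2m Dn} => [|[]].
move: Dn; rewrite m1 mul1n; case: (logn 2 n) => [|[|l]] Dn.
- by rewrite Dn in n_gt2.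
- by rewrite Dn in n_gt2.
- by rewrite Dn totient_pfactor //= mul1n expnS dvdn_mulr.
Qed.

Lemma totient_mul4_odd (n : nat) : odd n -> totient (4 * n) = (2 * totient n)%N.
Proof.
move=> n_odd.
by rewrite totient_coprime // (coprimeXl 2 (_ : coprime 2 n)) // coprime2n.
Qed.

Lemma totient_mul4_even (n : nat) : (0 < n)%N -> ~~ odd n ->
  totient (4 * n) = (4 * totient n)%N.
Proof.
move=> n_gt0 n_even; have [m co2m Dn] := pfactor_coprime (isT : prime 2) n_gt0.
have : (0 < logn 2 n)%N by rewrite logn_gt0 mem_primes n_gt0 dvdn2 n_even.
move: Dn; case: (logn 2 n) => // l -> _.
have -> : (4 * (m * 2 ^ l.+1) = m * 2 ^ l.+3)%N by rewrite !expnS; lia.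
have co j : coprime m (2 ^ j) by rewrite coprimeXr // coprime_sym.
by do 2!rewrite (totient_coprime (co _)) totient_pfactor //=; rewrite !expnS;
  lia.
Qed.

Lemma Cyclotomic_mul4_horner_i (n : nat) : (2 < n)%N ->
  (map_poly intr (Cyclotomic (4 * n))).['i] = (vpp n)%:~R :> algC.
Proof.
move=> n_gt2; have n_gt1 := ltnW n_gt2; have n_gt0 := ltnW n_gt1.
have n4_gt0 : (0 < 4 * n)%N by rewrite muln_gt0.
have [z prim_z] := C_prim_root_exists n4_gt0.
have z4 : n.-primitive_root (z ^+ 4).
  by have := exp_prim_root prim_z 4; rewrite gcdnMr mulKn.
(* Both composition formulas come from one criterion. Although -X^2 has leading coefficient -1,
   composing with it gives a monic polynomial, since [totient n] is even. *)
have comp_root (q : {poly int}) : n.-primitive_root (map_poly intr q).[z] ->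
    q \is monic \/ q = - 'X^2 /\ odd n ->
    ((size q).-1 * totient n = totient (4 * n))%N ->
    Cyclotomic (4 * n) = Cyclotomic n \Po q.
  move=> prim_q q_mon tot.
  have tot4 : (0 < totient (4 * n))%N by rewrite totient_gt0.
  apply: (Cyclotomic_unique _ _ _ _ prim_z).
  - by rewrite map_comp_poly rootE horner_comp; apply: root_Cyclotomic.
  - rewrite monicE lead_coef_comp; last first.
      by move: tot4; rewrite -tot; case: (size q) => [|[]].
    rewrite (monicP (Cyclotomic_monic n)) mul1r size_Cyclotomic.
    case: q_mon => [/monicP ->|[-> n_odd]]; first by rewrite expr1n.
    rewrite lead_coefN lead_coefXn /= -signr_odd.
    by have := dvdn_totient_even _ n_gt2; rewrite dvdn2 => /negPf->.
  - have := size_comp_poly (Cyclotomic n) q.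
    rewrite size_Cyclotomic /= mulnC tot.
    by move: tot4; case: (size (_ \Po _)) => [|k] /=; lia.
have i4 : 'i ^+ 4 = 1 :> algC by rewrite (exprM _ 2 2) sqrCi sqrrN expr1n.
have at1 : (map_poly intr (Cyclotomic n)).[1] = (vpp n)%:~R :> algC.
  by rewrite -[1]/(1%:~R) horner_map /= Cyclotomic_at1.
have [n_odd | n_even] := boolP (odd n).
- rewrite (comp_root (- 'X^2)).
  + by rewrite map_comp_poly horner_comp rmorphN rmorphXn /= map_polyX
      !hornerE sqrCi opprK.
  + rewrite rmorphN rmorphXn /= map_polyX !hornerE.
    (* A square root of 1 other than 1, because 4n does not divide 2n. *)
    have z2n : z ^+ (2 * n) = -1.
      have : (z ^+ (2 * n)) ^+ 2 == 1.
        by rewrite -exprM -mulnAC (prim_expr_order prim_z).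
      rewrite sqrf_eq1 -(prim_order_dvd prim_z) => /orP[|/eqP //].
      by move/(dvdn_leq (_ : 0 < 2 * n)%N); lia.
    (* Now -z^2 is a power of z whose exponent 2n + 2 has gcd 4 with 4n for n odd, so its order is
       n. *)
    have -> : - z ^+ 2 = z ^+ (2 * n + 2) by rewrite exprD z2n mulN1r.
    have := exp_prim_root prim_z (2 * n + 2).
    have -> : (2 * n + 2 = 4 * n./2.+1)%N by lia.
    have /eqP co : coprime n./2.+1 n.
      have {2}-> : n = (n./2.+1 + n./2)%N by lia.
      by rewrite /coprime gcdnDl; apply: coprimeSn.
    by rewrite -muln_gcdr co muln1 mulKn.
  + by right.
  + by rewrite size_polyN size_polyXn totient_mul4_odd.
- rewrite (comp_root 'X^4).
  + by rewrite map_comp_poly horner_comp map_polyXn !hornerE i4.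
  + by rewrite map_polyXn !hornerE.
  + by left; rewrite monicXn.
  + by rewrite size_polyXn totient_mul4_even.
Qed.

(** This fixes [totient (4 * n)] / 2 modulo 4, hence the power of i. For n even the totient is 4
    [totient n], a multiple of 8. For n odd it is 2 [totient n]: if n = p^k this is 2(p - 1) times
    an odd number, and if n has two prime factors then 4 divides [totient n]. *)
Lemma totient_mul4_mod8 (n : nat) : (2 < n)%N ->
  if (vpp n %% 4 == 3)%N then (totient (4 * n) %% 8 = 4)%N
  else (totient (4 * n) %% 8 = 0)%N.
Proof.
move=> n_gt2; have n_gt1 := ltnW n_gt2; have n_gt0 := ltnW n_gt1.
have := dvdn_totient_even _ n_gt2; rewrite dvdn2 => tot_even.
have [n_odd | n_even] := boolP (odd n); last first.
  have -> : (totient (4 * n) %% 8 = 0)%N by rewrite totient_mul4_even //; lia.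
  (* The only prime of n would be 2, which is not 3 modulo 4. *)
  case: ifP => // v3; exfalso.
  move: v3; rewrite /vpp; case Dn: (primes n) => [|p [|q s]] //.
  have : 2%N \in primes n by rewrite mem_primes n_gt0 dvdn2 n_even.
  by rewrite Dn inE => /eqP <-.
rewrite totient_mul4_odd //.
have odd_primes p : p \in primes n ->
    [/\ prime p, odd p, (0 < logn p n)%N & (p %| n)%N].
  move=> /[dup] p_n; rewrite mem_primes => /and3P[p_pr _ p_dvd].
  by rewrite logn_gt0; split=> //; apply: dvdn_odd n_odd.
rewrite /vpp; case Dn: (primes n) => [|p [|q s]] /=.
- by move/eqP: Dn; rewrite primes_eq0 ltnNge n_gt1.
- have [|p_pr p_odd l_gt0 _] := odd_primes p; first by rewrite Dn mem_head.
  have -> : totient n = (p.-1 * p ^ (logn p n).-1)%N.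
    by rewrite totientE // Dn big_seq1.
  have : odd (p ^ (logn p n).-1) by rewrite oddX p_odd orbT.
  move: (p ^ _)%N => a a_odd; have p_gt0 := prime_gt0 p_pr.
  case: ifP => p4.
    have [b ->] : exists b, p = (4 * b + 3)%N by exists (p %/ 4)%N; lia.
    have [c ->] : exists c, a = (2 * c + 1)%N by exists (a %/ 2)%N; lia.
    have -> : (2 * ((4 * b + 3).-1 * (2 * c + 1)) =
               (2 * b * c + b + c) * 8 + 4)%N by nia.
    by rewrite modnMDl.
  have [b ->] : exists b, p = (4 * b + 1)%N by exists (p %/ 4)%N; lia.
  by rewrite addn1 /= -!mulnA (mulnA 2 4) modnMr.
- have [|p_pr p_odd l_gt0 _] := odd_primes p; first by rewrite Dn mem_head.
  have [|q_pr q_odd _ q_n] := odd_primes q; first by rewrite Dn !inE eqxx orbT.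
  have q_p : q != p.
    by have := primes_uniq n; rewrite Dn /= inE negb_or => /andP[/andP[]];
      rewrite eq_sym.
  have [m co_pm Dn'] := pfactor_coprime p_pr n_gt0.
  (* The second prime q makes the cofactor m exceed 2, so both coprime factors of n have an even
     totient. *)
  have q_m : (q %| m)%N.
    move: q_n; rewrite {1}Dn' Gauss_dvdl //.
    by rewrite coprimeXr // prime_coprime // dvdn_prime2.
  have m_gt0 : (0 < m)%N by move: n_gt0; rewrite {1}Dn' muln_gt0 => /andP[].
  have gt2 r : prime r -> odd r -> (2 < r)%N by move=> /prime_gt1; lia.
  have m_gt2 : (2 < m)%N.
    exact: leq_trans (gt2 _ q_pr q_odd) (dvdn_leq m_gt0 q_m).
  rewrite {1}Dn' totient_coprime ?coprimeXr 1?coprime_sym //.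
  have p_gt2 : (2 < p ^ logn p n)%N.
    apply: leq_trans (gt2 _ p_pr p_odd) _.
    by rewrite -{1}(expn1 p) leq_pexp2l // prime_gt0.
  have /dvdnP[a ->] := dvdn_totient_even _ m_gt2.
  have /dvdnP[b ->] := dvdn_totient_even _ p_gt2.
  have -> : (2 * (a * 2 * (b * 2)) = a * b * 8)%N by lia.
  by rewrite modnMl.
Qed.

(** * The root of unity exp(2 i pi / m) over [R] *)

Definition expi {R : realType} (a : R) : complex R := Complex (cos a) (sin a).

Lemma expi_mulrn (R : realType) (a : R) (k : nat) :
  expi (a *+ k) = expi a ^+ k.
Proof.
elim: k => [|k IHk]; first by rewrite mulr0n /expi cos0 sin0.
rewrite exprS -IHk mulrS /expi cosD sinD; apply/eqP.
by rewrite eq_complex /= eqxx addrC eqxx.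
Qed.

(** The order k divides m. If k < m then 2k <= m, so the angle 2 pi k / m lies in [0, pi], where cos
    is injective; its cosine being 1, the angle would be 0. *)
Lemma prim_root_expi (R : realType) (m : nat) : (0 < m)%N ->
  m.-primitive_root (expi (pi / m%:R *+ 2 : R)).
Proof.
move=> m_gt0; have m_neq0 : m%:R != 0 :> R by rewrite pnatr_eq0 -lt0n.
have a_m k : pi / m%:R *+ 2 *+ k = pi * (2 * k)%:R / m%:R :> R.
  by rewrite -mulrnA -[LHS]mulr_natr mulrAC.
have zm : expi (pi / m%:R *+ 2 : R) ^+ m = 1.
  rewrite -expi_mulrn a_m natrM mulrA mulfK // mulr_natr /expi cos2pi.
  by rewrite mulr2n sinD sinpi mulr0 mul0r addr0.
have [k prim_k k_m] := prim_order_exists m_gt0 zm.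
have [mk | k_neq] := eqVneq m k; first by rewrite {1}mk.
have k2_le : (2 * k <= m)%N.
  by case/dvdnP: k_m k_neq m_gt0 => -[|[|c]] ->; nia.
have k_gt0 := prim_order_gt0 prim_k.
have := prim_expr_order prim_k; rewrite -expi_mulrn a_m => -[cos_1 _].
have pi0 := pi_gt0 R.
have k_ge0 : 0 <= pi * (2 * k)%:R / m%:R :> R.
  by rewrite divr_ge0 // mulr_ge0 // pi_ge0.
have/eqP : pi * (2 * k)%:R / m%:R = 0 :> R.
  apply: cos_inj; rewrite ?cos0 // in_itv /= ?lexx ?pi_ge0 // k_ge0 /=.
  by rewrite ler_pdivrMr ?ltr0n // ler_pM2l // ler_nat.
rewrite mulf_eq0 invr_eq0 (negPf m_neq0) orbF mulf_eq0 gt_eqF //= pnatr_eq0.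
by lia.
Qed.

(** With z = exp(2it), -(z - 1)^2 / z = 2 - z - 1/z = 2 - 2 cos(2t) = 4 sin(t)^2. *)
Lemma expi_sin2_pi (R : realType) (m : nat) :
  - (expi (pi / m%:R *+ 2 : R) - 1) ^+ 2 =
    real_complex R (sin2_pi R m) * expi (pi / m%:R *+ 2).
Proof.
rewrite /sin2_pi; move: (pi / _) => t.
have := sin2cos2 t; rewrite /expi cos_mulr2n sin_mulr2n.
move: (cos t) (sin t) => c s cs.
apply/eqP; rewrite eq_complex /=; apply/andP; split; apply/eqP; ring: cs.
Qed.

(** * Identification of [phi] *)

Lemma phi_csub (R : realType) (m : nat) (p : {poly int}) : (2 < m)%N ->
  (size p <= (totient m)./2.+1)%N ->
  Cyclotomic m = csub (totient m)./2 p -> phi R m = p.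
Proof.
set d := (totient m)./2 => m_gt2 szp Dp.
have m_gt1 := ltnW m_gt2; have m_gt0 := ltnW m_gt1.
have totE : totient m = d.*2.
  by have := dvdn_totient_even m m_gt2; rewrite /d dvdn2; lia.
pose x := sin2_pi R m; pose z := expi (pi / m%:R *+ 2 : R).
have prim_z : m.-primitive_root z by apply: prim_root_expi.
have xz : - (z - 1) ^+ 2 = real_complex R x * z by apply: expi_sin2_pi.
have z_neq0 : z != 0 by rewrite (prim_root_eq0 prim_z) -lt0n.
have mapC (q : {poly rat}) : map_poly (real_complex R) (map_poly ratr q) =
    map_poly ratr q.
  by rewrite -map_poly_comp; apply: eq_map_poly => a /=; rewrite fmorph_rat.
(* The degree bound e is left free: it is d for p, and the degree of the remainder r below. *)
have root_csub e (q : {poly rat}) : (size q <= e.+1)%N ->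
    root (map_poly ratr (csub e q)) z = root (map_poly (ratr : rat -> R) q) x.
  move=> szq; rewrite -[RHS](fmorph_root (real_complex R)) mapC map_csub !rootE.
  rewrite (horner_csub _ _ _ _ _ _ xz) ?size_map_poly //.
  by rewrite mulf_eq0 expf_eq0 (negPf z_neq0) andbF.
(* By symmetry the constant term of Phi_m equals its leading coefficient 1. *)
have pd : p`_d = (-1) ^+ d.
  have : (Cyclotomic m)`_0 = 1.
    rewrite Cyclotomic_palindromic // subn0.
    by have /monicP := Cyclotomic_monic m; rewrite lead_coefE size_Cyclotomic.
  by rewrite Dp coef0_csub => /(canRL (mulKr _)) /= ->;
    rewrite ?unitrX ?unitrN1 // mulr1 -exprVn invrN1.
have szpE : size p = d.+1.
  apply/eqP; rewrite eqn_leq szp /= ltnNge.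
  apply/negP => /leq_sizeP/(_ d (leqnn d)).
  by rewrite pd => /eqP; rewrite signr_eq0.
pose pQ := map_poly (intr : int -> rat) p.
have szpQ : size pQ = d.+1 by rewrite size_map_inj_poly //; apply: intr_inj.
have pQ_neq0 : pQ != 0 by rewrite -size_poly_gt0 szpQ.
have px : root (map_poly (ratr : rat -> R) pQ) x.
  rewrite -(root_csub d) ?szpQ // -map_csub -Dp.
  by rewrite (root_ratr_Cyclotomic _ _ _ _ prim_z).
(* If the remainder r of q had degree e < d, then [csub e r] would be a nonzero multiple of Phi_m,
   of degree at most 2e < 2d. *)
have pP (q : {poly rat}) : root (map_poly (ratr : rat -> R) q) x = (pQ %| q).
  apply/idP/idP => [qx | /dvdpP[r ->]]; last by rewrite rmorphM rootM px orbT.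
  rewrite /dvdp; set r := q %% pQ.
  have rx : root (map_poly (ratr : rat -> R) r) x.
    move: qx; rewrite {1}(divp_eq q pQ) rmorphD rmorphM !rootE hornerD hornerM.
    by rewrite /= (eqP px) mulr0 add0r.
  have [// | r_neq0] := eqVneq r 0.
  pose e := (size r).-1.
  have szr : size r = e.+1 by rewrite /e prednK // size_poly_gt0.
  have e_d : (e < d)%N by rewrite -ltnS -szr -szpQ ltn_modp.
  move: rx; rewrite -(root_csub e) ?szr //.
  rewrite (root_ratr_Cyclotomic _ _ _ _ prim_z).
  move/dvdp_leq; rewrite size_map_inj_poly ?size_Cyclotomic //;
    last exact: intr_inj.
  have -> : csub e r != 0.
    apply/eqP => /(congr1 (fun q : {poly rat} => q`_0)).
    rewrite coef0_csub coef0.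
    move/eqP; rewrite mulf_eq0 signr_eq0 /=.
    by rewrite /e -lead_coefE lead_coef_eq0 (negPf r_neq0).
  by move/(_ isT)/leq_trans/(_ (size_csub _ _ _)); rewrite totE; lia.
have phi_p : is_phi R m p.
  split; last first.
    have := Cyclotomic_at1 m m_gt1; rewrite Dp.
    (* Taking z = 1 and w = 0 gives p(0) = Phi_m(1) = [vpp m], which is positive. *)
    have e1 : - (1 - 1) ^+ 2 = 0 * 1 :> int by [].
    by rewrite (horner_csub _ _ _ _ _ szp e1) expr1n mul1r horner_coef0 => ->;
      rewrite ltz_nat vpp_gt0.
  (* The leading coefficient (-1)^d decides whether -p or p is monic. *)
  have [d_odd | d_even] := boolP (odd d); [right | left].
    split=> [|q]; last by rewrite rmorphN -scaleN1r dvdpZl ?oppr_eq0 ?oner_eq0.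
    rewrite rmorphN monicE lead_coefN lead_coefE szpQ coef_map /= pd.
    by rewrite -signr_odd d_odd expr1 rmorphN opprK.
  split=> [|q //]; rewrite monicE lead_coefE szpQ coef_map /= pd.
  by rewrite -signr_odd (negPf d_even).
have : is_phi R m (phi R m) by apply: (xgetPex 0 (ex_intro _ p phi_p)).
by move/is_phi_uniq; apply.
Qed.

(** * The value at 2 and its sign *)

Theorem theorem3 (R : realType) (n : nat) (n_ge3 : (3 <= n)%N) :
  ((vpp n = 1 %[mod 4])%Z \/ vpp n = 2%N ->
     (phi R (4 * n)).[2] = (vpp n)%:Z) /\
  ((vpp n = -1 %[mod 4])%Z ->
     (phi R (4 * n)).[2] = - (vpp n)%:Z).
Proof.
pose m := (4 * n)%N; pose d := (totient m)./2.
have m_gt2 : (2 < m)%N by rewrite /m; lia.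
have totE : totient m = d.*2.
  by have := dvdn_totient_even m m_gt2; rewrite /d dvdn2; lia.
have [|i|p szp Dp] := palindromic_csub _ d (Cyclotomic m).
- by rewrite size_Cyclotomic totE.
- by rewrite -totE; apply: Cyclotomic_palindromic; apply: ltnW.
rewrite -/m (phi_csub _ _ p) //.
have := Cyclotomic_mul4_horner_i n n_ge3; rewrite -/m Dp map_csub.
(* At z = i one has -(i - 1)^2 = 2i, so w = 2. *)
rewrite (horner_csub _ _ _ _ 2%:~R); first last.
- rewrite mulrz_nat sqrrB sqrCi expr1n; ring.
- by apply: leq_trans szp; apply: size_poly.
rewrite horner_map /= => Di.
have := totient_mul4_mod8 n n_ge3; rewrite -/m totE.
(* Here 2d is 4 or 0 modulo 8, so d is 2 or 0 modulo 4 and i^d is -1 or 1. In each case the other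
   conclusion has a false premise. *)
case: ifP => v4 d8.
  have d2 : 'i ^+ d = -1 :> algC.
    have -> : d = (d %/ 4 * 4 + 2)%N by lia.
    by rewrite exprD mulnC exprM (exprM _ 2 2) sqrCi sqrrN !expr1n mul1r.
  split; first by lia.
  move=> _; apply: (@intr_inj algC).
  by rewrite rmorphN /= -Di d2 mulN1r opprK.
have d0 : 'i ^+ d = 1 :> algC.
  have -> : d = (4 * (d %/ 4))%N by lia.
  by rewrite exprM (exprM _ 2 2) sqrCi sqrrN !expr1n.
split; last by lia.
by move=> _; apply: (@intr_inj algC); rewrite -Di d0 mul1r.
Qed.
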